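(* Let $\Gamma=(N,A,\hat I,\prec,\hat\chi,\gamma,u)$ be a spacetime game with perfect information, and let $\Sigma:\hat I\to A$ be a strategy profile of $\Gamma$. Then there exists a unique complete history $h$ of $\Gamma$ that is a restriction of $\Sigma$. Consequently, every strategy profile $\Sigma$ can be associated with the payoffs $(u(i,h))_{i\in N}$ of this complete history $h$, and this associates with $\Gamma$ a strategic game (game in normal form) with set of players $N$, strategy spaces $(\Sigma_i)_{i\in N}$ and these payoffs (the strategic form of $\Gamma$).
   Context: Minkowski spacetime is $\mathbb{R}^d$ ($d\ge 2$, usually $d=4$) with a flat metric of signature $(d-1,1)$; write its points as $(x,t)$ with $x\in\mathbb{R}^{d-1}$, $t\in\mathbb{R}$ (units with speed of light 1). A raw assignment is a partial function $\alpha$ from $\hat I$ to $A$ with $\alpha(P)\in\hat\chi(P)$ wherever it is defined; $\alpha(P)=\perp$ means undefined at $P$. A raw assignment $\alpha$ is a restriction of $\beta$ (and $\beta$ an extension of $\alpha$) if $\alpha(P)\ne\perp$ implies $\alpha(P)=\beta(P)$, for all $P$. A spacetime game with perfect information is a tuple $\Gamma=(N,A,\hat I,\prec,\hat\chi,\gamma,u)$ where: - $N$ is a set of agents and $A$ a set of actions; - $\hat I$ is a finite set of decision points $\hat I_{i,j}$, where $i\in N$ is the agent deciding at $\hat I_{i,j}$ and $j\in\mathbb{N}$ is an index; each has a location $\mathcal{L}(\hat I_{i,j})\in\mathbb{R}^d$; - $\prec$ (timelike precedence) is the relation induced by the locations: for decision points $P,Q$ with locations $(x_P,t_P)$ and $(x_Q,t_Q)$,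 $P\prec Q$ iff the locations are different and $t_Q-t_P\ge\|x_Q-x_P\|$ (lightlike separation counts as timelike; colocated points count as spacelike-separated); - $\hat\chi:\hat I\to\mathcal{P}(A)$ gives the actions available at each decision point; - $\gamma$ associates with each decision point $P$ its contingency coordinates $\gamma_P$ (written $\gamma_{i,j}$ for $P=\hat I_{i,j}$), a raw assignment defined only on decision points $Q\prec P$. Say that $Q$ actually precedes $P$ if $Q\prec P$ and $\gamma_Q$ is a restriction of $\gamma_P$. The contingency coordinates are required to be consistent: for all $P,Q\in\hat I$, $\gamma_P(Q)\neq\perp$ if and only if $Q$ actually precedes $P$; - $u$ assigns a real number (payoff) to each agent and complete history, where complete histories are defined next. A history is a raw assignment $h$ such that for all decision points $P,Q$: if $h(P)\ne\perp$ and $\gamma_P(Q)\neq\perp$ then $h(Q)=\gamma_P(Q)$. A history is complete if no history that assigns actions to strictly more decision points extends it; otherwise it is incomplete. A strategy of agent $i$ is a raw assignment defined exactly on the decision points $(\hat I_{i,j})_j$ of agent $i$; $\Sigma_i$ is the set of strategies of agent $i$. A strategy profile is a raw assignment defined on all of $\hat I$; equivalently, the union of one strategy for each agent, i.e. an element of $\prod_{i\in N}\Sigma_i$. *)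

(* Defs.v *)
From HB Require Import structures.
From mathcomp Require Import all_boot all_order all_algebra.
From mathcomp Require Import boolp classical_sets reals.

Set Implicit Arguments.
Unset Strict Implicit.
Unset Printing Implicit Defensive.

Import Order.TTheory GRing.Theory Num.Theory.
Local Open Scope ring_scope.

(* The norm that the analysis library puts on row vectors is the sup norm,
   hence this definition. *)
Definition euclidean_norm (R : realType) (n : nat) (x : 'rV[R]_n) : R :=
  Num.sqrt (\sum_(i < n) x 0 i ^+ 2).

(* A point (x, t) of R^d, with d - 1 space coordinates. *)
Definition event (R : realType) (d : nat) : Type := ('rV[R]_d.-1 * R)%type.

Definition timelike (R : realType) (d : nat) (p q : event R d) : Prop :=
  p <> q /\ euclidean_norm (q.1 - p.1) <= q.2 - p.2.

(* [None] plays the role of "undefined". *)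
Record raw_assignment (I : finType) (A : Type) (avail : I -> set A) :=
  RawAssignment {
    assign :> I -> option A;
    assign_avail : forall P a, assign P = Some a -> avail P a }.

Definition defined (I : finType) (A : Type) (avail : I -> set A)
    (alpha : raw_assignment avail) : pred I :=
  fun P => isSome (alpha P).

Definition restriction (I : finType) (A : Type) (avail : I -> set A)
    (alpha beta : raw_assignment avail) : Prop :=
  forall P, defined alpha P -> alpha P = beta P.

(* The components of a spacetime game with perfect information other than the
   payoffs, which are added in [spacetime_game] once complete histories are
   defined. The j-th decision point of agent i is the P with [owner P = i] and
   [point_index P = j], if there is one. Timelike precedence is not a
   component, being determined by [loc]. *)
Record game_form (R : realType) (d : nat) := GameForm {
  agent : Type;
  action : Type;
  decision_point : finType;
  owner : decision_point -> agent;
  point_index : decision_point -> nat;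
  loc : decision_point -> event R d;
  avail : decision_point -> set action;
  contingency : decision_point -> raw_assignment avail;
  label_inj : injective (fun P => (owner P, point_index P));
  contingency_prec : forall P Q,
    defined (contingency P) Q -> timelike (loc Q) (loc P);
  contingency_consistent : forall P Q,
    defined (contingency P) Q <->
    timelike (loc Q) (loc P) /\
    restriction (contingency Q) (contingency P) }.

Definition history (R : realType) (d : nat) (F : game_form R d)
    (h : raw_assignment (@avail R d F)) : Prop :=
  forall P Q, defined h P -> defined (contingency P) Q -> h Q = contingency P Q.

Definition complete (R : realType) (d : nat) (F : game_form R d)
    (h : raw_assignment (@avail R d F)) : Prop :=
  history h /\
  ~ exists g : raw_assignment (@avail R d F),
      [/\ history g, defined h \proper defined g & restriction h g].

Definition complete_history (R : realType) (d : nat) (F : game_form R d) :=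
  {h : raw_assignment (@avail R d F) | complete h}.

Record spacetime_game (R : realType) (d : nat) := SpacetimeGame {
  form :> game_form R d;
  utility : agent form -> complete_history form -> R }.

Definition strategy (R : realType) (d : nat) (F : game_form R d)
    (i : agent F) :=
  {s : raw_assignment (@avail R d F) | forall P, defined s P <-> owner P = i}.

Definition strategy_profile (R : realType) (d : nat) (F : game_form R d) :=
  {S : raw_assignment (@avail R d F) | forall P, defined S P}.

Section Join.
Variables (R : realType) (d : nat) (F : game_form R d).

Lemma join_avail (s : forall i : agent F, strategy i) P a :
  sval (s (owner P)) P = Some a -> avail P a.
Proof. exact: assign_avail. Qed.

Lemma join_defined (s : forall i : agent F, strategy i) P :
  defined (RawAssignment (@join_avail s)) P.
Proof. exact/(svalP (s (owner P)) P). Qed.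

(* The union of one strategy for each agent. *)
Definition join (s : forall i : agent F, strategy i) : strategy_profile F :=
  exist _ (RawAssignment (@join_avail s)) (@join_defined s).

Lemma raw_assignment_ext (al be : raw_assignment (@avail R d F)) :
  al =1 be -> al = be.
Proof.
case: al be => [f fP] [g gP] /= /funext fg.
by move: gP; rewrite -fg => gP; rewrite (Prop_irrelevance fP gP).
Qed.

Lemma join_bij : bijective join.
Proof.
pose part (S : raw_assignment (@avail R d F)) i P := if `[< owner P = i >] then S P else None.
have partA (S : strategy_profile F) i P a :
    part (sval S) i P = Some a -> avail P a.
  by rewrite /part; case: ifP => // _; exact: assign_avail.
have partD (S : strategy_profile F) i P :
    defined (RawAssignment (@partA S i)) P <-> owner P = i.
  rewrite /defined /= /part; case: asboolP => // Pi; split=> // _.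
  exact: (svalP S P).
exists (fun S i => exist _ (RawAssignment (@partA S i)) (@partD S i)).
- move=> s; apply: functional_extensionality_dep => i.
  apply: (eq_sig_hprop (fun=> @Prop_irrelevance _)); apply: raw_assignment_ext => P /=; rewrite /part /=.
  case: asboolP => [<-//|Pi].
  have := svalP (s i) P; rewrite /defined.
  by case: (sval (s i) P) => // a [/(_ isT)].
- move=> S; apply: (eq_sig_hprop (fun=> @Prop_irrelevance _)); apply: raw_assignment_ext => P /=.
  by rewrite /part; case: asboolP.
Qed.

End Join.

Definition payoffs_of (R : realType) (d : nat) (G : spacetime_game R d)
    (S : strategy_profile G) (v : agent G -> R) : Prop :=
  exists h : complete_history G,
    restriction (sval h) (sval S) /\ forall i, v i = utility i h.

Record strategic_game (R : realType) := StrategicGame {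
  player : Type;
  strategy_space : player -> Type;
  payoff : player -> (forall i, strategy_space i) -> R }.

Definition is_strategic_form (R : realType) (d : nat) (G : spacetime_game R d)
    (T : strategic_game R) : Prop :=
  exists w : agent G -> (forall i : agent G, strategy i) -> R,
    T = StrategicGame w /\ forall s, payoffs_of (join s) (fun i => w i s).

(* Main.v *)
(* A decision point P belongs to some history included in Sigma if and only if
   its contingency coordinates agree with Sigma: consistency makes all the
   points in the domain of gamma_P satisfy the same condition. The restriction
   of Sigma to these points is therefore the largest history included in Sigma.
   It is complete, because in a larger history an earliest added point P would
   have gamma_P included in Sigma after all. *)
Require Import Defs.
From mathcomp Require Import all_boot all_order all_algebra.
From mathcomp Require Import boolp classical_sets reals.

Set Implicit Arguments.
Unset Strict Implicit.
Unset Printing Implicit Defensive.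

Import Order.TTheory GRing.Theory Num.Theory.

Lemma euclidean_norm_ge0 (R : realType) n (x : 'rV[R]_n) :
  (0 <= euclidean_norm x)%R.
Proof. exact: sqrtr_ge0. Qed.

Lemma euclidean_norm_le0 (R : realType) n (x : 'rV[R]_n) :
  (euclidean_norm x <= 0)%R -> x = 0%R.
Proof.
rewrite leNgt sqrtr_gt0 -leNgt => sum_le0.
have sq_ge0 i : xpredT i -> (0 <= x 0%R i ^+ 2)%R by rewrite sqr_ge0.
have /eqP : (\sum_(i < n) x 0%R i ^+ 2 == 0)%R by rewrite eq_le sum_le0 sumr_ge0.
move/(psumr_eq0P sq_ge0) => x0; apply/rowP => i; rewrite mxE.
by apply/eqP; rewrite -sqrf_eq0 x0.
Qed.

(** Equal times would force spatial distance 0, hence equal events, which [timelike] excludes. Time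
    can thus serve as a strict measure for precedence. *)
Lemma timelike_lt (R : realType) d (p q : event R d) :
  timelike p q -> (p.2 < q.2)%R.
Proof.
case: p q => [x t] [y s] [/= pq le_xy].
have le_ts : (t <= s)%R by rewrite -subr_ge0 (le_trans (euclidean_norm_ge0 _) le_xy).
rewrite lt_neqAle le_ts andbT; apply/eqP => ts; apply: pq.
move: le_xy; rewrite ts subrr => /euclidean_norm_le0/eqP.
by rewrite subr_eq0 => /eqP ->.
Qed.

Section Play.
Variables (R : realType) (d : nat) (F : game_form R d).
Implicit Types (g h S : raw_assignment (@avail R d F)) (P Q : decision_point F).

Lemma restriction_trans g h S :
  restriction g h -> restriction h S -> restriction g S.
Proof.
move=> gh hS P gP; rewrite (gh _ gP) hS //.
by rewrite /defined -(gh _ gP).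
Qed.

(** One test on all of [contingency P] replaces a recursion along timelike precedence. *)
Definition play_fun S P :=
  if `[< restriction (contingency P) S >] then S P else None.

Lemma play_avail S P a : play_fun S P = Some a -> avail P a.
Proof. by rewrite /play_fun; case: ifP => // _; apply: assign_avail. Qed.

Definition play S := RawAssignment (@play_avail S).

Lemma playE S P : restriction (contingency P) S -> play S P = S P.
Proof. by move=> ?; rewrite /= /play_fun asboolT. Qed.

Lemma play_defined S P :
  defined (play S) P -> restriction (contingency P) S.
Proof. by rewrite /defined /= /play_fun; case: asboolP. Qed.

Lemma play_restriction S : restriction (play S) S.
Proof. by move=> P /play_defined/playE. Qed.

Lemma play_history S : history (play S).
Proof.
move=> P Q /play_defined gPS gPQ.
(* By consistency [contingency Q] is a restriction of [contingency P], hence of [S], so [Q] passes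
   the test too. *)
have [_ gQP] := (contingency_consistent P Q).1 gPQ.
by rewrite playE ?gPS //; apply: restriction_trans gPS.
Qed.

Lemma history_contingency h P :
  history h -> defined h P -> restriction (contingency P) h.
Proof. by move=> hist hP Q gPQ; rewrite (hist P Q). Qed.

Lemma history_sub_play h S :
  history h -> restriction h S -> restriction h (play S).
Proof.
move=> hist hS P hP; rewrite playE ?hS //.
by apply: restriction_trans hS; apply: history_contingency.
Qed.

Lemma restriction_subset g h :
  restriction g h -> defined g \subset defined h.
Proof.
by move=> gh; apply/fintype.subsetP => P gP; rewrite unfold_in -(gh _ gP).
Qed.

(** Here [h] is not assumed to be included in [S], so [history_sub_play] does not apply; the
    argument looks at a new point of least time instead. *)
Lemma history_extending_play S h : (forall P, defined S P) ->
  history h -> restriction (play S) h -> defined h \subset defined (play S).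
Proof.
move=> S_total hist ext; apply/fintype.subsetP => P0 hP0; apply/contraT => nP0.
pose new P := defined h P && ~~ defined (play S) P.
have new0 : new P0 by apply/andP.
case: (arg_minP (fun P => (loc P).2) new0) => P /andP[hP nP] first.
case/negP: nP; rewrite /defined playE; first exact: S_total.
move=> Q gPQ; have hQ := hist P Q hP gPQ.
have dQ : defined (play S) Q.
  (* Otherwise [Q] would be a new point strictly earlier than [P]. *)
  apply/contraT => nQ; have := timelike_lt (contingency_prec gPQ).
  rewrite ltNge first //; apply/andP; split=> //.
  by rewrite /defined hQ.
by rewrite -hQ -(ext _ dQ) play_restriction.
Qed.

Lemma play_complete S : (forall P, defined S P) -> complete (play S).
Proof.
move=> S_total; split; first exact: play_history.
case=> h [hist /properP[_ [P hP nP]] ext].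
by rewrite (fintype.subsetP (history_extending_play S_total hist ext)) in nP.
Qed.

Lemma complete_restriction_eq g h :
  complete g -> history h -> restriction g h -> g = h.
Proof.
move=> [_ g_max] hist gh; apply: raw_assignment_ext => P.
case gP : (defined g P); first exact: gh.
have hP : defined h P = false.
  apply/negP => hP; apply: g_max; exists h; split=> //.
  apply/properP; split; first exact: restriction_subset.
  by exists P => //; apply/negbT.
by move: gP hP; rewrite /defined; case: (g P); case: (h P).
Qed.

Lemma complete_history_uniq (S : strategy_profile F) :
  exists! h : complete_history F, restriction (sval h) (sval S).
Proof.
exists (exist _ _ (play_complete (svalP S))); split; first exact: play_restriction.
(* The completeness used here is that of [h]: it lies inside the history [play S], so it cannot be
   smaller. *)
move=> [h h_max] hS; apply: eq_exist; symmetry; apply: complete_restriction_eq => //.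
  exact: play_history.
exact: (history_sub_play h_max.1 hS).
Qed.

End Play.

Lemma payoffs_uniq (R : realType) d (G : spacetime_game R d)
  (S : strategy_profile G) : exists! v, payoffs_of S v.
Proof.
have [h [hS h_uniq]] := complete_history_uniq S.
exists (fun i => utility i h); split; first by exists h.
by move=> v [h' [/h_uniq <- vE]]; apply/funext => i; rewrite vE.
Qed.

(** Players and strategy spaces are fixed by [is_strategic_form], so only the payoff function can
    vary, and [payoffs_uniq] determines it at each [join s]. *)
Lemma strategic_form_uniq (R : realType) d (G : spacetime_game R d) :
  exists! T, is_strategic_form G T.
Proof.
have [v vP] := choice (fun S => payoffs_uniq (G := G) S).
exists (StrategicGame (fun i s => v (join s) i)); split.
  by exists (fun i s => v (join s) i); split=> // s; case: (vP (join s)).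
move=> _ [w [-> wP]]; congr StrategicGame; apply/funext => i; apply/funext => s.
by rewrite ((vP (join s)).2 _ (wP s)).
Qed.

Theorem theorem1 (R : realType) (d : nat) (hd : (2 <= d)%N)
    (G : spacetime_game R d) :
  (forall S : strategy_profile G,
     (exists! h : complete_history G, restriction (sval h) (sval S)) /\
     (exists! v : agent G -> R, payoffs_of S v)) /\
  (exists! T : strategic_game R, is_strategic_form G T).
Proof.
split; last exact: strategic_form_uniq.
by move=> S; split; [apply: complete_history_uniq | apply: payoffs_uniq].
Qed.
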